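(* There exist a sequence of finite groups $(G_i)_{i\ge 1}$ and, for each $i$, a nontrivial irreducible complex representation $\rho_i$ of $G_i$, such that for every fixed positive integer $t$, $$\lim_{i\to\infty}\ \Pr_{g_1,\ldots,g_t}\left[\ \left\| \frac{1}{t}\sum_{j=1}^t \rho_i(g_j)\right\|_{\mathrm{op}} = 1\ \right] = 1,$$ where $g_1,\ldots,g_t$ are independent and uniformly random elements of $G_i$.
   Context: Representations are finite-dimensional complex representations, taken to be unitary with respect to an inner product on the representation space, and $\|\cdot\|_{\mathrm{op}}$ is the operator norm with respect to that inner product. ''Nontrivial'' means not isomorphic to the trivial one-dimensional representation. The sequence $(G_i,\rho_i)$ does not depend on $t$. *)

(* Defs.v *)
From HB Require Import structures.
From mathcomp Require Import all_boot all_order all_algebra all_fingroup.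
From mathcomp Require Import spectral mxrepresentation.
From mathcomp Require Import complex.
From mathcomp Require Import all_classical all_reals all_analysis.

Set Implicit Arguments.
Unset Strict Implicit.
Unset Printing Implicit Defensive.

Import Order.TTheory GRing.Theory Num.Theory.
Import numFieldNormedType.Exports.

Local Open Scope classical_set_scope.
Local Open Scope ring_scope.
Local Open Scope complex_scope.

Definition trivial_mx (F : fieldType) (gT : finGroupType) (x : gT) : 'M[F]_1 :=
  1%:M.

Lemma trivial_mx_repr (F : fieldType) (gT : finGroupType) (G : {group gT}) :
  mx_repr G (@trivial_mx F gT).
Proof. by split=> // x y _ _; rewrite /trivial_mx mulmx1. Qed.

Definition trivial_repr (F : fieldType) (gT : finGroupType) (G : {group gT}) :
  mx_representation F G 1 := MxRepresentation (@trivial_mx_repr F gT G).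

(* The norm of the standard Hermitian inner product on row vectors, the one
   with respect to which [unitarymx] is unitarity. *)
Definition l2norm (R : realType) (n : nat) (v : 'rV[R[i]]_n) : R :=
  Num.sqrt (\sum_(j < n) ComplexField.Normc.normc (v 0 j) ^+ 2).

(* Matrices act on row vectors from the right, as in [mx_representation]. The
   set is nonempty and bounded above, so [sup] is the genuine supremum. *)
Definition opnorm (R : realType) (n : nat) (A : 'M[R[i]]_n) : R :=
  sup [set l2norm (v *m A) | v in [set v : 'rV[R[i]]_n | l2norm v <= 1]].

Definition unitary_repr (R : realType) (gT : finGroupType) (G : {group gT})
    (n : nat) (rG : mx_representation R[i] G n) : Prop :=
  forall x, x \in G -> rG x \is unitarymx.

(* On T = {ffun 'I_t -> gT} the uniform law is the product of the uniform laws
   on gT, i.e. the joint law of t independent uniform elements of gT. *)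
Definition uniform_pr (R : realType) (T : finType) (E : pred T) : R :=
  #|E|%:R / #|T|%:R.

Definition average_repr (R : realType) (gT : finGroupType) (G : {group gT})
    (n : nat) (rG : mx_representation R[i] G n) (t : nat)
    (g : {ffun 'I_t -> gT}) : 'M[R[i]]_n :=
  t%:R^-1 *: \sum_(j < t) rG (g j).

(* Main.v *)
From HB Require Import structures.
Require Import Defs.
From mathcomp Require Import all_boot all_order all_algebra all_fingroup.
From mathcomp Require Import spectral mxrepresentation.
From mathcomp Require Import complex.
From mathcomp Require Import all_classical all_reals all_analysis.
From mathcomp Require Import zify ring lra.

Import Order.TTheory GRing.Theory Num.Theory.
Import numFieldNormedType.Exports.

Set Implicit Arguments.
Unset Strict Implicit.
Unset Printing Implicit Defensive.

Local Open Scope classical_set_scope.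
Local Open Scope ring_scope.
Local Open Scope complex_scope.

(** Take [G_N = S_3^N] acting on the [N]-th tensor power of the two-dimensional
    irreducible representation of [S_3], realised on functions of a sign vector
    [s] in [{1,-1}^N]: the transpositions flip signs, and the rotation [x] in
    [(Z/3)^N] multiplies the basis vector [s] by [omega^(s . x)]. Given
    [g_1, ..., g_t], group the coordinates [k] according to the tuple
    [(g_1 k, ..., g_t k)]. The indicator of the sign vectors whose sum over every
    group vanishes modulo 3 is fixed by each [g_j], and it is nonzero unless some
    group is a singleton. On a common fixed vector the average has norm 1. Some
    group is a singleton with probability at most [N (1 - 6^-t)^(N-1)], which
    tends to 0 for fixed [t]. *)

(** * Operator norm of an average of unitary matrices *)

Lemma normc_ge0 (R : realType) (z : R[i]) : 0 <= ComplexField.Normc.normc z.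
Proof. by case: z => a b; rewrite sqrtr_ge0. Qed.

Lemma normc_sum (R : realType) (I : Type) (r : seq I) (F : I -> R[i]) :
  ComplexField.Normc.normc (\sum_(i <- r) F i)
    <= \sum_(i <- r) ComplexField.Normc.normc (F i).
Proof.
elim/big_rec2: _ => [|i x y _ le_yx]; first by rewrite ComplexField.Normc.normc0.
by apply: le_trans (le_normcD _ _) _; rewrite lerD2l.
Qed.

(** Cauchy-Schwarz against the constant vector: both sides are double sums over [j] and [k], and
    termwise [a j * a k] is at most the mean of the two squares. *)
Lemma sqr_sum_le (R : realType) (t : nat) (a : 'I_t -> R) :
  (\sum_j a j) ^+ 2 <= t%:R * \sum_j a j ^+ 2.
Proof.
have -> : t%:R * \sum_j a j ^+ 2 = \sum_(j < t) \sum_(k < t) (a j ^+ 2 + a k ^+ 2) / 2.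
  transitivity (\sum_(j < t) (t%:R * a j ^+ 2 + \sum_k a k ^+ 2) / 2).
    by rewrite -mulr_suml big_split /= -mulr_sumr sumr_const card_ord -mulr_natl; field.
  apply: eq_bigr => j _.
  by rewrite -mulr_suml big_split /= sumr_const card_ord mulr_natl.
rewrite expr2 mulr_suml; apply: ler_sum => j _; rewrite mulr_sumr.
apply: ler_sum => k _; have := sqr_ge0 (a j - a k); nra.
Qed.

Lemma normc_sumr_sqr_le (R : realType) (t : nat) (z : 'I_t -> R[i]) :
  ComplexField.Normc.normc (\sum_j z j) ^+ 2
    <= t%:R * \sum_j ComplexField.Normc.normc (z j) ^+ 2.
Proof.
apply: le_trans (sqr_sum_le _).
by rewrite lerXn2r ?nnegrE ?normc_ge0 ?sumr_ge0 ?normc_sum // => i _; apply: normc_ge0.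
Qed.

Lemma normc_nat (R : realType) (n : nat) :
  ComplexField.Normc.normc (n%:R : R[i]) = n%:R.
Proof. by rewrite (normcMn 1 n) ComplexField.Normc.normc1. Qed.

Lemma l2norm_ge0 (R : realType) n (v : 'rV[R[i]]_n) : 0 <= l2norm v.
Proof. exact: sqrtr_ge0. Qed.

Lemma sqr_l2norm (R : realType) n (v : 'rV[R[i]]_n) :
  l2norm v ^+ 2 = \sum_j ComplexField.Normc.normc (v 0 j) ^+ 2.
Proof. by rewrite sqr_sqrtr // sumr_ge0 // => j _; apply: sqr_ge0. Qed.

Lemma l2norm_eq0 (R : realType) n (v : 'rV[R[i]]_n) : l2norm v = 0 -> v = 0.
Proof.
move=> v0; apply/rowP => j; rewrite mxE; apply: ComplexField.Normc.eq0_normc.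
have := sqr_l2norm v; rewrite v0 expr0n => /esym/eqP.
rewrite psumr_eq0 => [/allP/(_ j)|i _]; last exact: sqr_ge0.
by rewrite mem_index_enum sqrf_eq0 => /(_ isT)/eqP.
Qed.

Lemma l2normZ (R : realType) n (c : R[i]) (v : 'rV[R[i]]_n) :
  l2norm (c *: v) = ComplexField.Normc.normc c * l2norm v.
Proof.
apply/eqP; rewrite -(@eqrXn2 _ 2) ?mulr_ge0 ?l2norm_ge0 ?normc_ge0 //.
rewrite exprMn !sqr_l2norm mulr_sumr; apply/eqP/eq_bigr => j _.
by rewrite mxE ComplexField.Normc.normcM exprMn.
Qed.

Lemma sqr_l2normE (R : realType) n (v : 'rV[R[i]]_n) :
  (l2norm v ^+ 2)%:C = (v *m (v ^t*)%sesqui) 0 0.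
Proof.
rewrite sqr_l2norm mxE rmorph_sum /=; apply: eq_bigr => j _.
by rewrite !mxE -normCK /= rmorphXn.
Qed.

Lemma l2norm_unitary (R : realType) n (v : 'rV[R[i]]_n) (U : 'M[R[i]]_n) :
  U \is unitarymx -> l2norm (v *m U) = l2norm v.
Proof.
move=> /unitarymxP uU.
apply/eqP; rewrite -(@eqrXn2 _ 2) ?l2norm_ge0 //; apply/eqP.
apply: (@complexI R); rewrite !sqr_l2normE.
by rewrite trmx_mul map_mxM mulmxA -(mulmxA v) uU mulmx1.
Qed.

(** Cauchy-Schwarz in each coordinate bounds the squared norm of the sum by [t] times the sum of the
    squared norms, hence by [t ^ 2]. *)
Lemma l2norm_average_le1 (R : realType) n t (w : 'I_t -> 'rV[R[i]]_n) :
  (0 < t)%N -> (forall j, l2norm (w j) <= 1) ->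
  l2norm (t%:R^-1 *: \sum_j w j) <= 1.
Proof.
move=> t0 w1; have tR : 0 < t%:R :> R by rewrite ltr0n.
rewrite -(@expr_le1 _ 2) ?l2norm_ge0 // l2normZ exprMn.
rewrite ComplexField.Normc.normcV normc_nat exprVn mulrC ler_pdivrMr ?exprn_gt0 // mul1r.
rewrite sqr_l2norm; apply: (@le_trans _ _ (t%:R * \sum_j l2norm (w j) ^+ 2)).
  under [in leRHS]eq_bigr do rewrite sqr_l2norm.
  rewrite exchange_big mulr_sumr; apply: ler_sum => k _; rewrite summxE.
  exact: normc_sumr_sqr_le.
rewrite expr2 ler_pM2l // -[t in leRHS]card_ord -sumr_const.
by apply: ler_sum => j _; rewrite expr_le1 ?l2norm_ge0.
Qed.

(** Unitary matrices preserve the unit ball and averaging stays inside it, so 1 is an upper bound;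
    the normalised common fixed vector attains it. *)
Lemma opnorm_average_eq1 (R : realType) (gT : finGroupType) (G : {group gT})
    n (rG : mx_representation R[i] G n) t (g : {ffun 'I_t -> gT}) (v : 'rV_n) :
  unitary_repr rG -> (0 < t)%N -> (forall j, g j \in G) ->
  v != 0 -> (forall j, v *m rG (g j) = v) -> opnorm (average_repr rG g) = 1.
Proof.
move=> uG t0 gG v0 vfix; rewrite /opnorm; set E := [set _ | _ in _].
have avgE w : w *m average_repr rG g = t%:R^-1 *: \sum_j w *m rG (g j).
  by rewrite -scalemxAr mulmx_sumr.
have E_le1 : ubound E 1.
  move=> _ [w /= w1 <-]; rewrite avgE; apply: l2norm_average_le1 => // j.
  by rewrite l2norm_unitary //; apply: uG.
apply/eqP; rewrite eq_le; apply/andP; split.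
  (* The zero vector shows that the set under the supremum is nonempty. *)
  apply: ge_sup => //; exists (l2norm ((0 : 'rV_n) *m average_repr rG g)); exists 0 => //=.
  by rewrite -(scale0r (0 : 'rV_n)) l2normZ ComplexField.Normc.normc0 mul0r.
have nv0 : l2norm v != 0 by apply: contra_neq v0; apply: l2norm_eq0.
pose w := ((l2norm v)^-1)%:C *: v.
have w1 : l2norm w = 1.
  rewrite l2normZ /= expr0n addr0 sqrtr_sqr ger0_norm ?invr_ge0 ?l2norm_ge0 //.
  by rewrite mulVf.
apply: ub_le_sup; first by exists 1.
exists w; first by rewrite /= w1.
rewrite avgE (eq_bigr (fun=> w)) => [|j _]; last by rewrite -scalemxAl vfix.
rewrite sumr_const card_ord -[w *+ t]scaler_nat scalerA mulVf ?scale1r //.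
by rewrite pnatr_eq0 -lt0n.
Qed.

(** * Tensor powers of representations *)

Lemma ffun_neq (I : finType) (T : eqType) (f h : {ffun I -> T}) :
  f != h -> exists i, f i != h i.
Proof.
move=> fh; apply/existsP; apply: contraNT fh => /existsPn eqfh.
by apply/eqP/ffunP => i; apply/eqP; rewrite -[_ == _]negbK eqfh.
Qed.

Section TensorPower.

Variables (C : fieldType) (B : finGroupType) (I : finType) (m : B -> I -> I -> C).
Variable N : nat.

Let gT : finGroupType := {dffun forall k : 'I_N, B}.
Let S : finType := {ffun 'I_N -> I}.

Definition tensor_coef (g : gT) (s s' : S) : C := \prod_k m (g k) (s k) (s' k).

Definition tensor_mx (g : gT) : 'M[C]_#|S| :=
  \matrix_(i, j) tensor_coef g (enum_val i) (enum_val j).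

Lemma prodr_eq (s s' : S) : \prod_k (s k == s' k)%:R = (s == s')%:R :> C.
Proof.
have [<-|ss'] := eqVneq s s'; first by rewrite big1 // => k _; rewrite eqxx.
have [k sk] := ffun_neq ss'.
by rewrite (bigD1 k) //= (negPf sk) mul0r.
Qed.

Lemma sum_enum_val (F : S -> C) : \sum_(i < #|S|) F (enum_val i) = \sum_s F s.
Proof. by rewrite [RHS](reindex _ (onW_bij _ (enum_val_bij S))). Qed.

(** The mixed-product rule for Kronecker products: a sum over index functions of a product is a
    product of sums. *)
Lemma sum_tensor_coefM (f h : 'I_N -> I -> I -> C) (s s' : S) :
  \sum_(u : S) (\prod_k f k (s k) (u k)) * (\prod_k h k (u k) (s' k))
    = \prod_k \sum_c f k (s k) c * h k c (s' k).
Proof.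
by rewrite bigA_distr_bigA; apply: eq_bigr => u _; rewrite -big_split.
Qed.

Hypothesis m1 : forall a b, m 1%g a b = (a == b)%:R.
Hypothesis mM : forall x y a b, m (x * y)%g a b = \sum_c m x a c * m y c b.

Lemma tensor_mx_repr (G : {group gT}) : mx_repr G tensor_mx.
Proof.
split=> [|x y _ _]; apply/matrixP => i j; rewrite !mxE.
  rewrite -(inj_eq enum_val_inj) -prodr_eq.
  by apply: eq_bigr => k _; rewrite oneg_ffun m1.
under eq_bigr do rewrite !mxE.
rewrite (sum_enum_val (fun u => tensor_coef x _ u * tensor_coef y u _)).
rewrite (sum_tensor_coefM (fun k => m (x k)) (fun k => m (y k))).
by apply: eq_bigr => k _; rewrite mulg_ffun mM.
Qed.

Definition tensor_repr (G : {group gT}) : mx_representation C G #|S| :=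
  MxRepresentation (tensor_mx_repr G).

(* [c p q] are the coordinates of the elementary matrix E_pq in the matrices
   [m x]; tensoring these expansions puts every elementary matrix of the
   tensor power in its enveloping algebra. *)
Lemma tensor_repr_irr (c : I -> I -> B -> C) :
  (0 < #|I|)%N ->
  (forall p q a b, \sum_x c p q x * m x a b = ((a == p) && (b == q))%:R) ->
  mx_irreducible (tensor_repr [set: gT]).
Proof.
move=> I0 cE; apply/mx_irrP; split=> [|U /mxmoduleP Umod /matrix0Pn[i [j Uij]]].
  by rewrite card_ffun expn_gt0 I0.
have deltaE (p q : 'I_#|S|) : delta_mx p q =
    \sum_(x : gT) (\prod_k c (enum_val p k) (enum_val q k) (x k)) *: tensor_mx x.
  apply/matrixP => a b; rewrite !mxE summxE.
  under eq_bigr do rewrite !mxE -big_split /=.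
  rewrite -(bigA_distr_bigA (fun k y => c (enum_val p k) (enum_val q k) y *
     m y (enum_val a k) (enum_val b k))) /=.
  under eq_bigr do rewrite cE -mulnb natrM.
  by rewrite big_split /= !prodr_eq !(inj_eq enum_val_inj) -natrM mulnb.
have Udelta p q : (U *m delta_mx p q <= U)%MS.
  rewrite deltaE mulmx_sumr; apply: summx_sub => x _.
  by rewrite -scalemxAr scalemx_sub // Umod ?inE.
(* Row [i] of [U *m delta_mx j q] is the nonzero scalar [U i j] times the [q]-th basis vector, so
   the row space of [U] contains the whole basis. *)
rewrite -sub1mx; apply/row_subP => q; rewrite row1.
have : (row i (U *m delta_mx j q) <= U)%MS by rewrite (submx_trans (row_sub _ _)).
have -> : row i (U *m delta_mx j q) = U i j *: delta_mx 0 q.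
  apply/rowP => k; rewrite !mxE (bigD1 j) //= big1 ?addr0 => [|l lj].
    by rewrite mxE !eqxx.
  by rewrite mxE (negPf lj) mulr0.
by move=> /(scalemx_sub (U i j)^-1); rewrite scalerA mulVf ?scale1r.
Qed.

End TensorPower.

Lemma tensor_repr_unitary (R : realType) (B : finGroupType) (I : finType)
    (m : B -> I -> I -> R[i]) N
    (m1 : forall a b, m 1%g a b = (a == b)%:R)
    (mM : forall x y a b, m (x * y)%g a b = \sum_c m x a c * m y c b) :
  (forall x a b, Num.conj (m x a b) = m x^-1%g b a) ->
  unitary_repr (tensor_repr (N := N) m1 mM [set: _]).
Proof.
move=> mV x xG; apply/unitarymxP.
(* Writing the identity as the image of [x * x^-1] leaves only the claim that the conjugate
   transpose at [x] is the matrix of [x^-1], which [mV] gives factor by factor. *)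
rewrite -(repr_mx1 (tensor_repr m1 mM [set: _])) -(mulgV x) repr_mxM ?inE //.
congr (_ *m _); apply/matrixP => i j; rewrite !mxE.
rewrite rmorph_prod; apply: eq_bigr => k _; rewrite invg_ffun; exact: mV.
Qed.

Lemma tensor_repr_fix (C : fieldType) (B : finGroupType) (I : finType)
    (m : B -> I -> I -> C) N
    (m1 : forall a b, m 1%g a b = (a == b)%:R)
    (mM : forall x y a b, m (x * y)%g a b = \sum_c m x a c * m y c b)
    (f : {ffun 'I_N -> I} -> C) (g : {dffun forall k : 'I_N, B}) :
  (forall s : {ffun _ -> _}, \sum_u f u * \prod_k m (g k) (u k) (s k) = f s) ->
  (\row_i f (enum_val i)) *m tensor_repr m1 mM [set: _] g = \row_i f (enum_val i).
Proof.
move=> fE; apply/rowP => j; rewrite !mxE -fE -sum_enum_val.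
by apply: eq_bigr => i _; rewrite !mxE.
Qed.

(** * The two-dimensional representation of [S_3] *)

(* [S_3] as the semidirect product of [Z/3] by the sign action of [Z/2]. *)
Definition S3 := (bool * 'Z_3)%type.
HB.instance Definition _ := Finite.on S3.

Definition S3_mul (x y : S3) : S3 := (x.1 (+) y.1, x.2 + (-1) ^+ x.1 * y.2).
Definition S3_inv (x : S3) : S3 := (x.1, - ((-1) ^+ x.1 * x.2)).
Definition S3_one : S3 := (false, 0).

Lemma S3_mulA : associative S3_mul.
Proof.
move=> [a x] [b y] [c z]; congr pair; rewrite /= ?addbA // signr_addb.
by rewrite mulrDr addrA mulrA.
Qed.

Lemma S3_mul1 : left_id S3_one S3_mul.
Proof. by move=> [a x]; rewrite /S3_mul /= add0r mul1r. Qed.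

Lemma S3_mulV : left_inverse S3_one S3_inv S3_mul.
Proof. by move=> [a x]; rewrite /S3_mul /= addbb addNr. Qed.

HB.instance Definition _ := Finite_isGroup.Build S3 S3_mulA S3_mul1 S3_mulV.

Lemma card_S3 : #|{: S3}| = 6%N.
Proof. by rewrite card_prod card_bool card_ord. Qed.

Section CubeRoot.

Variable R : realType.

Definition omega : R[i] := (- (1 / 2)) +i* (Num.sqrt 3 / 2).

Lemma sqr_omega : omega ^+ 2 = - omega - 1.
Proof.
have s3 : Num.sqrt 3 ^+ 2 = 3 :> R by rewrite sqr_sqrtr.
rewrite expr2 /omega; apply/eqP; rewrite eq_complex /=; apply/andP; split; apply/eqP.
  by move: (Num.sqrt 3) s3 => s s3; nra.
by field.
Qed.

Lemma omega3 : omega ^+ 3 = 1.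
Proof. by rewrite exprS sqr_omega; have := sqr_omega => w; ring: w. Qed.

Lemma conj_omega : Num.conj omega = omega ^+ 2.
Proof.
rewrite sqr_omega; apply/eqP; rewrite eq_complex /=; apply/andP.
by split; apply/eqP; field.
Qed.

Definition char3 (u : 'Z_3) : R[i] := omega ^+ u.

Lemma char30 : char3 0 = 1. Proof. by []. Qed.

Lemma char3D : {morph char3 : u v / u + v >-> u * v}.
Proof. by move=> u v; rewrite /char3 expr_mod ?omega3 // exprD. Qed.

Lemma conj_char3 u : Num.conj (char3 u) = char3 (- u).
Proof.
rewrite /char3 rmorphXn. rewrite /= conj_omega -exprM.
by case: u => [[|[|[|//]]] //= _]; rewrite -[LHS](expr_mod _ omega3).
Qed.

Lemma sum_char3 (a : 'Z_3) : \sum_x char3 (a * x) = 3%:R * (a == 0)%:R.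
Proof.
rewrite /char3 !big_ord_recl big_ord0.
case: a => [[|[|[|//]]] //= _]; rewrite ?expr0 ?expr1 -?exprM /=.
- by ring.
- by rewrite -[(_ %% _)%N]/2%N sqr_omega; ring.
- by rewrite -[(_ %% _)%N]/2%N sqr_omega; ring.
Qed.

(** The representation induced from the character [char3] of the rotation subgroup: a monomial
    matrix in which the rotations act on the two basis vectors by [char3] and its inverse. *)
Definition S3_coef (x : S3) (a b : bool) : R[i] :=
  (b == a (+) x.1)%:R * char3 ((-1) ^+ a * x.2).

Lemma S3_coef1 a b : S3_coef 1%g a b = (a == b)%:R.
Proof. by rewrite /S3_coef /= addbF mulr0 char30 mulr1 eq_sym. Qed.

Lemma S3_coefM x y a b : S3_coef (x * y)%g a b = \sum_c S3_coef x a c * S3_coef y c b.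
Proof.
rewrite (bigD1 (a (+) x.1)) //= big1 ?addr0 => [|c /negPf ca]; last first.
  by rewrite /S3_coef ca !mul0r.
rewrite /S3_coef /= eqxx mul1r addbA signr_addb mulrCA -char3D; congr (_ * char3 _).
by rewrite mulrDr mulrA.
Qed.

Lemma S3_coef_conj x a b : Num.conj (S3_coef x a b) = S3_coef x^-1%g b a.
Proof.
rewrite /S3_coef rmorphM /= conj_char3 conjC_nat.
have [->|ba] := eqVneq b (a (+) x.1).
  by rewrite -addbA addbb addbF eqxx signr_addb mulrN -mulrA signrMK.
by rewrite [a == _](_ : _ = false) ?mul0r //; case: a b x.1 ba => [] [] [].
Qed.

(** The flip [p (+) q] is fixed by the coefficients; summing over rotations is then Fourier
    inversion on [Z/3], which isolates row [p] because [(-1)^a - (-1)^p] vanishes modulo 3 only for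
    [a = p]. *)
Lemma S3_coef_span p q a b :
  \sum_x (x.1 == p (+) q)%:R * char3 (- ((-1) ^+ p * x.2)) / 3%:R * S3_coef x a b
    = ((a == p) && (b == q))%:R.
Proof.
rewrite -(pair_bigA _ (fun e x => (e == p (+) q)%:R * char3 (- ((-1) ^+ p * x)) / 3%:R
   * S3_coef (e, x) a b)) /=.
rewrite (bigD1 (p (+) q)) //= [X in _ + X]big1 ?addr0 => [|c /negPf cpq]; last first.
  by rewrite big1 // => x _; rewrite cpq !mul0r.
transitivity (3%:R^-1 * (b == a (+) (p (+) q))%:R
              * \sum_x char3 (((-1) ^+ a - (-1) ^+ p) * x)).
  rewrite mulr_sumr; apply: eq_bigr => x _.
  by rewrite /S3_coef /= eqxx mul1r mulrBl char3D; ring.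
rewrite sum_char3 (_ : (_ == 0) = (a == p)); last by case: a p => [] [].
have [<-|] := eqVneq a p; last by rewrite !mulr0.
by rewrite addbA addbb addFb (eq_sym b) mulr1 mulrAC mulVf ?mul1r ?pnatr_eq0.
Qed.

End CubeRoot.

(** * Common fixed vectors *)

Lemma exists_sub_card (T : finType) (A : {set T}) (r : nat) :
  (r <= #|A|)%N -> exists2 D : {set T}, D \subset A & #|D| = r.
Proof.
move=> rA; exists [set x in take r (enum A)]%SET.
  by apply/fintype.subsetP => x; rewrite inE => /mem_take; rewrite mem_enum.
rewrite cardsE; apply: etrans (_ : size (take r (enum A)) = r).
  by apply/card_uniqP/take_uniq/enum_uniq.
by rewrite size_takel // -cardE.
Qed.

(* As [(-1)^b = 1 + b] in [Z/3], the sum is [#|A| + #|D|], and a residue class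
   modulo 3 is met by some [#|D| <= #|A|] except when [#|A| = 1]. *)
Lemma exists_sign_sum0 (T : finType) (A : {set T}) : #|A| != 1%N ->
  exists D : {set T}, \sum_(x in A) (-1) ^+ (x \in D) = 0 :> 'Z_3.
Proof.
move=> A1; pose r := ((2 * #|A|) %% 3)%N.
have rA : (r <= #|A|)%N.
  by have := ltn_pmod (2 * #|A|) (isT : 0 < 3)%N; rewrite /r; move: A1; lia.
have [D DA Dr] := exists_sub_card rA; exists D.
transitivity ((#|A| + r)%:R : 'Z_3); last first.
  by apply/val_inj; rewrite /r Zp_nat /= modnDmr -mulSn modnMr.
have sgE (b : bool) : (-1) ^+ b = 1 + b%:R :> 'Z_3 by case: b; apply/val_inj.
under eq_bigr do rewrite sgE.
rewrite big_split /= sumr_const natrD; congr (_ + _).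
rewrite -natr_sum -big_mkcondr /= sum1_card -Dr; congr (_%:R).
apply: eq_card => x; rewrite unfold_in /=.
by apply: andb_idl; apply: (fintype.subsetP DA).
Qed.

(** The fibres of [tp] are disjoint and none is a singleton, so signs can be chosen on each fibre
    separately and glued. *)
Lemma exists_signs_sum0 (T I : finType) (tp : I -> T) :
  (forall k, exists2 l, l != k & tp l = tp k) ->
  exists s : {ffun I -> bool},
    forall tau, \sum_(k | tp k == tau) (-1) ^+ s k = 0 :> 'Z_3.
Proof.
move=> tpP.
have /fin_all_exists [D DP] (tau : T) : exists D : {set I},
    \sum_(x in [set k | tp k == tau]%SET) (-1) ^+ (x \in D) = 0 :> 'Z_3.
  apply: exists_sign_sum0; apply/negP => /cards1P[k tauk].
  have [l lk tpl] := tpP k.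
  have /finset.setP tpE := tauk; have [] := (tpE l, tpE k).
  by rewrite !inE (negPf lk) eqxx tpl => ->.
exists [ffun k => k \in D (tp k)] => tau; rewrite -[RHS](DP tau).
by apply: eq_big => [k|k /eqP <-]; rewrite ?inE // ffunE.
Qed.

Section FixedVector.

Variables (R : realType) (N t : nat).
Variable g : {ffun 'I_t -> {dffun forall k : 'I_N, S3}}.

Definition coord_type (k : 'I_N) : {ffun 'I_t -> S3} := [ffun j => g j k].

Definition balanced (s : {ffun 'I_N -> bool}) : bool :=
  [forall tau, \sum_(k | coord_type k == tau) (-1) ^+ s k == 0 :> 'Z_3].

(** All coordinates of type [tau] receive the same flip [(tau j).1], so each group sum changes at
    most by a global sign. *)
Lemma balanced_shift j (s : {ffun 'I_N -> bool}) :
  balanced [ffun k => s k (+) (g j k).1] = balanced s.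
Proof.
apply: eq_forallb => tau.
have -> : \sum_(k | coord_type k == tau) (-1) ^+ [ffun k => s k (+) (g j k).1] k =
    (-1) ^+ (tau j).1 * \sum_(k | coord_type k == tau) (-1) ^+ s k :> 'Z_3.
  rewrite mulr_sumr; apply: eq_bigr => k /eqP <-.
  by rewrite !ffunE signr_addb mulrC.
by case: (tau j).1; rewrite ?mulN1r ?oppr_eq0 ?mul1r.
Qed.

(** The rotation part of [g j] is constant on each group and factors out of a group sum that
    vanishes. *)
Lemma balanced_char j (s : {ffun 'I_N -> bool}) : balanced s ->
  \sum_k (-1) ^+ s k * (g j k).2 = 0.
Proof.
move=> /forallP bs; rewrite (partition_big coord_type predT) //= big1 // => tau _.
rewrite (eq_bigr (fun k => (-1) ^+ s k * (tau j).2)) => [|k /eqP <-].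
  by rewrite -mulr_suml (eqP (bs tau)) mul0r.
by rewrite ffunE.
Qed.

Lemma balanced_fix j (s : {ffun 'I_N -> bool}) :
  \sum_(u : {ffun 'I_N -> bool})
     (balanced u)%:R * \prod_k S3_coef R (g j k) (u k) (s k) = (balanced s)%:R.
Proof.
(* The flips in [g j] carry only [u0] to [s]. It is balanced exactly when [s] is, and its total
   phase is then 1. *)
pose u0 := [ffun k => s k (+) (g j k).1].
rewrite (bigD1 u0) //= [X in _ + X]big1 ?addr0 => [|u uu0]; last first.
  have [k uk] := ffun_neq uu0.
  rewrite (bigD1 k) //= /S3_coef (_ : (s k == _) = false) ?mul0r ?mulr0 //.
  by move: uk; rewrite ffunE; case: (u k) (s k) (g j k).1 => [] [] [].
rewrite balanced_shift; have [bs|] := boolP (balanced s); last by rewrite mul0r.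
rewrite mul1r /S3_coef big_split /= big1 => [|k _]; last first.
  by rewrite ffunE -addbA addbb addbF eqxx.
rewrite mul1r -(big_morph _ (@char3D R) (char30 R)) balanced_char ?char30 //.
by rewrite balanced_shift.
Qed.

End FixedVector.

(** * Coordinate types occurring only once *)

Lemma card_bigcup_le (J S : finType) (A : J -> {set S}) b :
  (forall i, #|A i| <= b)%N -> (#|(\bigcup_i A i)%SET| <= #|J| * b)%N.
Proof.
move=> Ab; apply: (@leq_trans (\sum_i #|A i|)); last first.
  by rewrite -sum_nat_const; apply: leq_sum.
elim/big_rec2: _ => [|i x y _ le]; first by rewrite cards0.
by apply: leq_trans (leq_card_setU _ _) _; rewrite leq_add2l.
Qed.

(** Union bound over the isolated position [k] and its value [c]: each of the other positions must
    avoid [c]. *)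
Lemma card_ffun_isolated (T : finType) n :
  (#|[pred h : {ffun 'I_n -> T} | [exists k, forall l, (l != k) ==> (h l != h k)]]|
     <= n * (#|T| * #|T|.-1 ^ n.-1))%N.
Proof.
pose F k c : 'I_n -> pred T := fun l => if l == k then pred1 c else predC1 c.
apply: (@leq_trans #|(\bigcup_(k : 'I_n) \bigcup_(c : T) [set h | h \in family (F k c)])%SET|).
  apply/subset_leq_card/fintype.subsetP => h; rewrite inE => /existsP[k /forallP hk].
  apply/finset.bigcupP; exists k => //; apply/finset.bigcupP; exists (h k) => //; rewrite inE.
  apply/familyP => l; rewrite /F; have := hk l.
  by have [->|lk] := eqVneq l k; rewrite !inE //= => _; rewrite eqxx.
rewrite -[n in (n * _)%N]card_ord; apply: card_bigcup_le => k; apply: card_bigcup_le => c.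
rewrite cardsE card_family foldrE big_image /= (bigD1 k) //= {1}/F eqxx card1 mul1n.
rewrite (eq_bigr (fun=> #|T|.-1)) => [|l /negPf lk]; last first.
  by rewrite /F lk cardC1.
by rewrite prod_nat_const cardC1 card_ord.
Qed.

(** With [q] the square root of [z], the geometric sum dominates [i.+1 * q ^ i], so it is at most
    [(1 - q)^-1]; the second factor [q ^ i] still tends to 0. *)
Lemma cvg_natS_geometric (R : realType) (z : R) : 0 <= z < 1 ->
  (fun i => i.+1%:R * z ^+ i) @ \oo --> (0 : R).
Proof.
move=> /andP[z0 z1]; pose q := Num.sqrt z.
have q0 : 0 <= q by exact: sqrtr_ge0.
have q1 : q < 1 by rewrite -sqrtr1 ltr_sqrt.
have zq : z = q ^+ 2 by rewrite sqr_sqrtr.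
have qn i : i.+1%:R * q ^+ i <= (1 - q)^-1.
  rewrite -[leRHS]mul1r ler_pdivlMr ?subr_gt0 // mulrC.
  apply: (@le_trans _ _ (1 - q ^+ i.+1)); last by rewrite gerBl exprn_ge0.
  rewrite -[1 - q ^+ i.+1]opprB subrX1 -mulNr opprB ler_wpM2l //.
    by rewrite subr_ge0 ltW.
  rewrite -[i.+1 in leLHS]card_ord -sumr_const mulr_suml; apply: ler_sum => j _.
  by rewrite mul1r ler_wiXn2l //; [exact: ltW|rewrite -ltnS].
apply: (@squeeze_cvgr _ _ _ _ (fun=> 0) (geometric (1 - q)^-1 q)).
- near=> i; rewrite mulr_ge0 ?exprn_ge0 //= zq -exprM mulnC exprM expr2 mulrA.
  by rewrite ler_wpM2r ?exprn_ge0.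
- exact: cvg_cst.
- by apply: cvg_geometric; rewrite ger0_norm.
Unshelve. all: by end_near. Qed.

Lemma uniform_pr_le1 (R : realType) (T : finType) (E : pred T) : uniform_pr R E <= 1.
Proof.
(* For empty [T] the convention [0^-1 = 0] makes the quotient 0. *)
rewrite /uniform_pr; have [->|T0] := posnP #|T|; first by rewrite invr0 mulr0 ler01.
by rewrite ler_pdivrMr ?ltr0n // mul1r ler_nat max_card.
Qed.

(* Transposing [g], the coordinate types are independent and uniform. *)
Lemma card_isolated_type N t :
  (#|[pred g : {ffun 'I_t -> {dffun forall k : 'I_N, S3}} |
        [exists k, forall l, (l != k) ==> (coord_type g l != coord_type g k)]]|
     <= N * (6 ^ t * (6 ^ t).-1 ^ N.-1))%N.
Proof.
have <- : #|{: {ffun 'I_t -> S3}}| = (6 ^ t)%N by rewrite card_ffun card_S3 card_ord.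
apply: leq_trans (card_ffun_isolated _ _).
pose tr (g : {ffun 'I_t -> {dffun forall k : 'I_N, S3}}) := [ffun k => coord_type g k].
have tr_inj : injective tr.
  move=> g h /ffunP gh; apply/ffunP => j; apply/ffunP => k.
  by have := gh k; rewrite !ffunE => /ffunP/(_ j); rewrite !ffunE.
rewrite -(fintype.card_image tr_inj); apply/subset_leq_card/fintype.subsetP => h.
move=> /fintype.imageP[g /existsP[k /forallP gk] ->]; rewrite inE; apply/existsP; exists k.
by apply/forallP => l; rewrite !ffunE.
Qed.

(** Outside [E] some coordinate type is isolated; the count of such tuples is divided by the total
    [(6 ^ t) ^ N.+1]. *)
Lemma uniform_pr_no_isolated (R : realType) N t
    (E : pred {ffun 'I_t -> {dffun forall k : 'I_N.+1, S3}}) :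
  (forall g, (forall k, exists2 l, l != k & coord_type g l = coord_type g k) -> E g) ->
  1 - N.+1%:R * (1 - (6 ^ t)%:R^-1) ^+ N <= uniform_pr R E.
Proof.
move=> goodE; pose T : finType := {ffun 'I_t -> {dffun forall k : 'I_N.+1, S3}}.
have c0 : (0 < 6 ^ t)%N by rewrite expn_gt0.
have cardT : #|{: T}| = ((6 ^ t) ^ N.+1)%N.
  rewrite card_ffun card_dep_ffun foldrE big_image /= prod_nat_const card_S3.
  by rewrite !card_ord -!expnM mulnC.
have leT : (#|{: T}| <= #|E| + N.+1 * (6 ^ t * (6 ^ t).-1 ^ N))%N.
  rewrite -(cardID E) leq_add //.
  apply: leq_trans (card_isolated_type N.+1 t).
  apply/subset_leq_card/fintype.subsetP => g; rewrite !inE andbT; apply: contraNT => nbad.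
  apply: goodE => k; move: nbad => /existsPn/(_ k)/forallPn[l].
  by rewrite negb_imply negbK => /andP[lk /eqP]; exists l.
have cR : (6 ^ t)%:R != 0 :> R by rewrite pnatr_eq0 -lt0n.
have T0 : 0 < #|{: T}|%:R :> R by rewrite cardT ltr0n expn_gt0 c0.
rewrite /uniform_pr ler_pdivlMr // mulrBl mul1r lerBlDr.
apply: (@le_trans _ _ (#|E| + N.+1 * (6 ^ t * (6 ^ t).-1 ^ N))%:R); first by rewrite ler_nat.
rewrite natrD lerD2l cardT !natrM !natrX exprS -subn1 natrB // natrX.
rewrite natrX in cR; move: (6 ^+ t) cR => c c0R.
(* Extracting [c ^ N] from [(c - 1) ^ N] makes the two sides equal. *)
have -> : c - 1 = c * (1 - c^-1) by rewrite mulrBr mulr1 mulfV.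
by rewrite exprMn le_eqVlt; apply/orP; left; apply/eqP; ring.
Qed.

(** * Operator norm 1 with probability tending to 1 *)

Lemma opnorm_no_isolated (R : realType) N t
    (g : {ffun 'I_t -> {dffun forall k : 'I_N, S3}}) :
  (0 < t)%N ->
  (forall k, exists2 l, l != k & coord_type g l = coord_type g k) ->
  opnorm (average_repr (tensor_repr (@S3_coef1 R) (@S3_coefM R) [set: _]) g) = 1.
Proof.
move=> t0 /exists_signs_sum0[s sP].
pose f (u : {ffun 'I_N -> bool}) : R[i] := (balanced g u)%:R.
apply: (@opnorm_average_eq1 _ _ _ _ _ _ _ (\row_i f (enum_val i))) => //.
- exact/tensor_repr_unitary/S3_coef_conj.
- by move=> j; rewrite inE.
- apply/eqP => /rowP/(_ (enum_rank s)); rewrite !mxE enum_rankK /f => /eqP.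
  rewrite (_ : balanced g s) ?oner_eq0 //.
  by apply/forallP => tau; rewrite sP.
- by move=> j; apply: tensor_repr_fix => u; apply: balanced_fix.
Qed.

Theorem mainTheorem1 (R : realType) :
  exists (gT : nat -> finGroupType) (n : nat -> nat)
         (rho : forall i, mx_representation R[i] [set: gT i]%G (n i)),
    (forall i, [/\ unitary_repr (rho i),
                   mx_irreducible (rho i)
                 & ~ mx_rsim (rho i) (trivial_repr R[i] [set: gT i]%G)]) /\
    forall t : nat, (0 < t)%N ->
      (fun i => uniform_pr R
         (fun g : {ffun 'I_t -> gT i} => opnorm (average_repr (rho i) g) == 1))
        @ \oo --> (1 : R).
Proof.
(* The shift to [i.+1] factors gives dimension [2 ^ i.+1], which is never 1 and so rules out the
   trivial representation. *)
exists (fun i => {dffun forall k : 'I_i.+1, S3}), (fun i => #|{ffun 'I_i.+1 -> bool}|).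
exists (fun i => tensor_repr (@S3_coef1 R) (@S3_coefM R) [set: _]); split=> [i|t t0].
  split.
  - exact/tensor_repr_unitary/S3_coef_conj.
  - by apply: tensor_repr_irr; [rewrite card_bool | exact: S3_coef_span].
  - by move=> /mxrank_rsim; rewrite card_ffun card_bool card_ord expnS; lia.
have c0 : 0 < (6 ^ t)%:R :> R by rewrite ltr0n expn_gt0.
apply: (@squeeze_cvgr _ _ _ _
  (fun i => 1 - i.+1%:R * (1 - (6 ^ t)%:R^-1) ^+ i) (fun=> 1)).
- near=> i; rewrite uniform_pr_le1 andbT; apply: uniform_pr_no_isolated => g gP.
  by rewrite opnorm_no_isolated.
- rewrite -[1 in X in _ --> X]subr0; apply: cvgB; first exact: cvg_cst.
  apply: cvg_natS_geometric.
  by rewrite subr_ge0 invf_le1 // ler1n expn_gt0 ltrBlDr ltrDl invr_gt0 c0.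
- exact: cvg_cst.
Unshelve. all: by end_near. Qed.
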